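(* Let $n_1,\ldots,n_5\ge 2$ be integers and $a_i=n_i-1$ for $i\in[5]$. Then \[ m_0(1,n_1,\ldots,n_5)=1+\sum_{i=1}^5a_i+\sum_{1\le i<j\le 5}a_ia_j+\max_{G\in\mathcal I_5}\sum_{e\in E(G)}\Delta_e . \] Equivalently, the final maximum may be taken over (not necessarily full) subgraphs of stars and triangles on $[5]$.
   Context: Write $[r]=\{1,\ldots,r\}$. Let $X_1,\ldots,X_r$ be finite sets with $|X_i|=n_i$. A family $\mathcal F\subseteq X_1\times\cdots\times X_r$ is viewed as an $r$-partite $r$-graph with (disjoint) parts $X_1,\ldots,X_r$: a tuple $(x_1,\ldots,x_r)$ is the edge whose vertices are $x_1\in X_1,\ldots,x_r\in X_r$, so two tuples $\mathbf x,\mathbf y$ are disjoint edges if and only if $x_i\ne y_i$ for all $i\in[r]$. Let $\nu(\mathcal F)$ be the maximum number of pairwise disjoint edges in $\mathcal F$, and $\tau(\mathcal F)$ the minimum size of a vertex set meeting every edge of $\mathcal F$. The number $m_0(1,n_1,\ldots,n_r)$ is the maximum size of a family $\mathcal F\subseteq X_1\times\cdots\times X_r$ satisfying $\nu(\mathcal F)\le 1<\tau(\mathcal F)$; equivalently, any two members of $\mathcal F$ agree in at least one coordinate, and no vertex is common to all members of $\mathcal F$. Here $r=5$. For $X\subseteq[5]$ put $a_X:=\prod_{i\in X}a_i$, with $a_\emptyset:=1$. For a $2$-subset $e\in\binom{[5]}2$ write $\overline e:=[5]\setminus e$ and $\Delta_e:=a_{\overline e}-a_e$. An intersecting graph is a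 (simple) graph in which every pair of edges shares a common vertex. $\mathcal I_5$ denotes the set of all intersecting graphs on vertex set $[5]$, including the empty graph. *)

(* Defs.v *)
From HB Require Import structures.
From mathcomp Require Import all_boot all_order all_algebra.

Set Implicit Arguments.
Unset Strict Implicit.
Unset Printing Implicit Defensive.

Import Order.TTheory GRing.Theory Num.Theory.
Local Open Scope ring_scope.

Section PartiteHypergraphs.
Variables (r : nat) (X : 'I_r -> finType).

(* The parts need not be disjoint as types: a vertex carries the index of the
   part it belongs to. *)
Definition vertex : finType := {i : 'I_r & X i}.

Definition edge : finType := {dffun forall i : 'I_r, X i}.

Definition edge_vertices (x : edge) : {set vertex} :=
  [set Tagged X (x i) | i : 'I_r].

Definition matching (M : {set edge}) : bool :=
  [forall x in M, forall y in M,
     (x != y) ==> [disjoint edge_vertices x & edge_vertices y]].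

Definition nu (F : {set edge}) : nat :=
  \max_(M : {set edge} | (M \subset F) && matching M) #|M|.

Definition vertex_cover (F : {set edge}) (C : {set vertex}) : bool :=
  [forall x in F, ~~ [disjoint edge_vertices x & C]].

(* For r > 0 the full vertex set is a cover of every family, so the minimum is
   a genuine one. *)
Definition tau (F : {set edge}) : nat :=
  #|[arg min_(C < [set: vertex] | vertex_cover F C) #|C|]|.

(* The maximum over an empty collection of families is 0. *)
Definition m0 (s : nat) : nat :=
  \max_(F : {set edge} | (nu F <= s < tau F)%N) #|F|.

End PartiteHypergraphs.

Section Graphs.
Variable k : nat.

(* A simple graph on 'I_k is given by its edge set. *)
Definition graph (G : {set {set 'I_k}}) : bool := [forall e in G, #|e| == 2].

Definition intersecting_graphs : {set {set {set 'I_k}}} :=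
  [set G : {set {set 'I_k}} | graph G &&
     [forall e in G, forall f in G, e :&: f != set0]].

Definition star (v : 'I_k) : {set {set 'I_k}} :=
  [set e : {set 'I_k} | (#|e| == 2) && (v \in e)].

Definition triangle (T : {set 'I_k}) : {set {set 'I_k}} :=
  [set e : {set 'I_k} | (#|e| == 2) && (e \subset T)].

Definition star_triangle_subgraphs : {set {set {set 'I_k}}} :=
  [set G : {set {set 'I_k}} | [exists v, G \subset star v] ||
           [exists T : {set 'I_k}, (#|T| == 3) && (G \subset triangle T)]].

Variable a : 'I_k -> int.

Definition aprod (Y : {set 'I_k}) : int := \prod_(i in Y) a i.

Definition Delta (e : {set 'I_k}) : int := aprod (~: e) - aprod e.

(* The neutral value 0 adds no competitor when the empty graph is in GG, as
   it then also contributes the sum 0. *)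
Definition max_Delta (GG : {set {set {set 'I_k}}}) : int :=
  \big[Num.max/0]_(G in GG) \sum_(e in G) Delta e.

End Graphs.

(* Main.v *)
(* Fix a base point [o] and send an edge [x] to its agreement set, the set of
   coordinates where [x] equals [o].  Take a nontrivial intersecting family of
   maximum size and, among those, with the largest total agreement with [o].
   Replacing a value [v] of coordinate [i] by [o i] keeps the family
   intersecting and preserves its size, so it either does nothing or creates a
   common vertex; in the second case coordinate [i] only takes the values [o i]
   and [v], and no two members differ at [i] alone.  Let I be the set of these
   bad coordinates.
   - If I is empty, the agreement sets pairwise meet and have at least two
     elements; those of size two form an intersecting graph G, and counting by
     agreement set bounds the family by the expression for G.
   - |I| = 1 or 2 is impossible (for 2, a new edge could be added).
   - If T is a 3-subset of I, the members lie in the box where the coordinates in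
     T take two values, and flipping one of them shows that they fill at most
     half of it.  Flipping all of T shows that the edges agreeing with [o] in at
     least two coordinates of T fill at least half of the same box, and the
     first case applies to that family.
   Conversely each intersecting graph G gives a family, by prescribing which
   agreement sets are allowed. *)
Require Import Defs.
From HB Require Import structures.
From mathcomp Require Import all_boot all_order all_fingroup all_algebra.
Import Order.TTheory GRing.Theory Num.Theory.

Set Implicit Arguments.
Unset Strict Implicit.
Unset Printing Implicit Defensive.

(** * Matching and covering numbers in terms of common coordinates *)

Section IntersectingFamilies.
Variables (r : nat) (X : 'I_r -> finType).
Implicit Types (x y z o : edge X) (F : {set edge X}) (S T : {set 'I_r}).

Definition intersecting F : bool :=
  [forall x in F, forall y in F, [exists i, x i == y i]].

Definition no_common_vertex F : bool :=
  [forall i, forall v : X i, [exists x in F, x i != v]].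

Lemma intersectingP F :
  reflect {in F &, forall x y, exists i, x i = y i} (intersecting F).
Proof.
apply: (iffP forall_inP) => [FI x y xF yF | FI x xF].
  by have /existsP[i /eqP xyi] := forall_inP (FI x xF) y yF; exists i.
apply/forall_inP => y yF; have [i xyi] := FI x y xF yF.
by apply/existsP; exists i; rewrite xyi.
Qed.

Lemma no_common_vertexP F :
  reflect (forall i (v : X i), exists2 x, x \in F & x i != v)
          (no_common_vertex F).
Proof.
apply: (iffP forallP) => [FN i v | FN i].
  exact/exists_inP/(forallP (FN i)).
by apply/forallP => v; apply/exists_inP/FN.
Qed.

Lemma in_edge_vertices x i (v : X i) :
  (Tagged X v \in edge_vertices x) = (x i == v).
Proof.
apply/imsetP/eqP => [[j _ /eqP] | <-]; last by exists i.
move=> /eqP e; have := congr1 tag e => /= ij; subst j.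
by move/eqP: e; rewrite eq_Tagged => /eqP.
Qed.

Lemma disjoint_edge_vertices x y :
  [disjoint edge_vertices x & edge_vertices y] = [forall i, x i != y i].
Proof.
apply/pred0P/forallP => [xy i | xy [i v]] /=.
  have := xy (Tagged X (x i)); rewrite /= !in_edge_vertices eqxx /=.
  by rewrite eq_sym => ->.
rewrite !in_edge_vertices; apply/andP => -[/eqP xv /eqP yv].
by have := xy i; rewrite xv yv eqxx.
Qed.

Lemma nu_le1 F : 0 < r -> (nu F <= 1) = intersecting F.
Proof.
move=> r0; apply/bigmax_leqP/intersectingP => [FI x y xF yF | FI M].
  have [<- | xy] := eqVneq x y; first by exists (Ordinal r0).
  suff /existsP[i /eqP xyi] : [exists i, x i == y i] by exists i.
  apply: contraT => /existsPn xyD.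
  pose M := [set x; y].
  have := FI M; rewrite cards2 xy; apply; apply/andP; split.
    by apply/subsetP => z; rewrite !inE => /orP[] /eqP ->.
  have xyd : [disjoint edge_vertices x & edge_vertices y].
    by rewrite disjoint_edge_vertices; apply/forallP.
  apply/forall_inP => z zM; apply/forall_inP => w wM; apply/implyP.
  move: zM wM; rewrite !inE => /orP[] /eqP -> /orP[] /eqP ->; rewrite ?eqxx // => _.
  by rewrite disjoint_sym.
case/andP=> /subsetP MF /forall_inP MM; rewrite leqNgt; apply/negP => /card_gt1P.
case=> x [y [xM yM xy]]; have := forall_inP (MM x xM) y yM.
rewrite xy disjoint_edge_vertices /= => /forallP xyD.
by have [i xyi] := FI x y (MF _ xM) (MF _ yM); have := xyD i; rewrite xyi eqxx.
Qed.

(** A cover with at most one vertex lies in some [[set u]], and a covering singleton is a common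
    vertex. The edge [o] supplies [u] when the cover is empty. *)
Lemma tau_gt1 o F : 0 < r -> (1 < tau F) = no_common_vertex F.
Proof.
move=> r0; rewrite /tau; case: arg_minnP => [|C Ccov Cmin].
  apply/forall_inP => x _; apply/pred0Pn; exists (Tagged X (x (Ordinal r0))).
  by rewrite /= in_edge_vertices eqxx inE.
apply/idP/no_common_vertexP => [C1 i v | FN].
  apply/exists_inP; apply: contraLR C1.
  rewrite negb_exists_in -leqNgt => /forall_inP Fv.
  have := Cmin [set Tagged X v]; rewrite cards1; apply.
  apply/forall_inP => x xF; apply/pred0Pn; exists (Tagged X v) => /=.
  by rewrite in_edge_vertices inE eqxx andbT -[_ == _]negbK Fv.
rewrite ltnNge; apply/negP => C1.
have [u Cu] : exists u, C \subset [set u].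
  have [-> | [u uC]] := set_0Vmem C; last first.
    by exists u; apply/subsetP => w wC; rewrite inE (card_le1_eqP C1 w u).
  by exists (Tagged X (o (Ordinal r0))); rewrite sub0set.
case: u => i v in Cu *; have [x xF] := FN i v; apply/negP; rewrite negbK.
have /pred0Pn[w /andP[/= xw /(subsetP Cu)]] := forall_inP Ccov x xF.
by rewrite inE => /eqP wE; move: xw; rewrite wE in_edge_vertices.
Qed.

Lemma m0_leq (m : nat) o : 0 < r ->
  (forall F, intersecting F -> no_common_vertex F -> #|F| <= m) -> m0 X 1 <= m.
Proof.
move=> r0 Fm; apply/bigmax_leqP => F.
by rewrite nu_le1 // (tau_gt1 o) // => /andP[]; apply: Fm.
Qed.

Lemma leq_m0 o F : 0 < r ->
  intersecting F -> no_common_vertex F -> #|F| <= m0 X 1.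
Proof.
move=> r0 FI FN; apply: (leq_bigmax_cond F).
by rewrite nu_le1 // (tau_gt1 o) // FI.
Qed.

End IntersectingFamilies.

(** * Compression towards a base point *)

Section Compression.
Variables (r : nat) (X : 'I_r -> finType) (o : edge X).
Implicit Types (x y z : edge X) (F : {set edge X}) (S T : {set 'I_r}).

Definition agreement x : {set 'I_r} := [set i | x i == o i].

Definition reset S x : edge X := finfun (fun i => if i \in S then o i else x i).

Lemma resetE S x i : reset S x i = if i \in S then o i else x i.
Proof. by rewrite ffunE. Qed.

Lemma reset0 x : reset set0 x = x.
Proof. by apply/ffunP => i; rewrite resetE inE. Qed.

Lemma reset_setU1 i S x : reset (i |: S) x = reset [set i] (reset S x).
Proof. by apply/ffunP => j; rewrite !resetE !inE; case: (j == i). Qed.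

Lemma reset1_id i x : x i = o i -> reset [set i] x = x.
Proof. by move=> xi; apply/ffunP => j; rewrite resetE inE; case: eqP => // ->. Qed.

Lemma agreement_reset1 i x : agreement (reset [set i] x) = i |: agreement x.
Proof. by apply/setP => j; rewrite !inE resetE inE; case: (j == i); rewrite ?eqxx. Qed.

Lemma reset_closed F S :
  {in S, forall i x, x \in F -> reset [set i] x \in F} ->
  forall x, x \in F -> reset S x \in F.
Proof.
move=> FS x xF; have [m] := ubnP #|S|; elim: m => // m IHm in S FS *.
have [-> _ | [i iS]] := set_0Vmem S; first by rewrite reset0.
rewrite (cardsD1 i) iS ltnS => Sm; rewrite -(setD1K iS) reset_setU1.
apply: (FS) => //; apply: IHm => // j; rewrite inE => /andP[_]; apply: FS.
Qed.

Definition total_agreement F := \sum_(x in F) #|agreement x|.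

(** The shifting operator of extremal set theory. An edge whose reset is already in [F] stays put,
    which makes the map injective on [F]. *)
Definition push F i (v : X i) x : edge X :=
  if (x i == v) && (reset [set i] x \notin F) then reset [set i] x else x.

Lemma push_injective F i (v : X i) : {in F &, injective (push F v)}.
Proof.
move=> x y xF yF; rewrite /push.
case: ifPn => [/andP[/eqP xi rx] | _]; case: ifPn => [/andP[/eqP yi ry] | _] //.
- move=> /ffunP e; apply/ffunP => j; have := e j; rewrite !resetE inE.
  by case: eqP => // ->; rewrite xi yi.
- by move=> e; rewrite e yF in rx.
- by move=> e; rewrite -e xF in ry.
Qed.

Lemma push_off F i (v : X i) x j : j != i -> push F v x j = x j.
Proof. by rewrite /push; case: ifP => // _ ji; rewrite resetE inE (negPf ji). Qed.

Lemma intersecting_push F i (v : X i) :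
  v != o i -> intersecting F -> intersecting (push F v @: F).
Proof.
move=> vo /intersectingP FI; apply/intersectingP.
move=> _ _ /imsetP[x xF ->] /imsetP[y yF ->].
have [j xyj] := FI x y xF yF.
have [ji | ji] := eqVneq j i; last by exists j; rewrite !push_off.
subst j; rewrite /push.
case: ifPn => [/andP[/eqP xi rx] | xN]; case: ifPn => [/andP[/eqP yi ry] | yN].
- by exists i; rewrite !resetE inE eqxx.
(* Here [y] has value [v] at [i] but does not move, so its reset is in [F]. That reset meets [x]
   away from [i], because [x i = v] differs from [o i]; there [x] and [y] are unchanged. *)
- move: yN; rewrite -xyj xi eqxx negbK /= => ry.
  have [k xrk] := FI _ _ xF ry; exists k.
  move: xrk; rewrite !resetE inE; case: eqP => // ki; subst k.
  by rewrite xi => e; rewrite e eqxx in vo.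
- move: xN; rewrite xyj yi eqxx negbK /= => rx.
  have [k xrk] := FI _ _ rx yF; exists k.
  move: xrk; rewrite !resetE inE; case: eqP => // ki; subst k.
  by rewrite yi => e; rewrite e eqxx in vo.
- by exists i.
Qed.

Lemma total_agreement_push F i (v : X i) x :
  v != o i -> x \in F -> x i = v -> reset [set i] x \notin F ->
  total_agreement F < total_agreement (push F v @: F).
Proof.
move=> vo xF xi rx; rewrite /total_agreement.
rewrite (big_imset _ (@push_injective F i v)) /=.
rewrite (bigD1 x) //= [ltnRHS](bigD1 x) //= -addSn leq_add //.
  rewrite /push xi eqxx rx /= agreement_reset1 cardsU1.
  by rewrite inE xi (negPf vo).
apply: leq_sum => y _; rewrite /push; case: ifP => // _.
by rewrite agreement_reset1 subset_leq_card // subsetUr.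
Qed.

Definition extremal F :=
  [/\ intersecting F, no_common_vertex F,
      forall F', intersecting F' -> no_common_vertex F' -> #|F'| <= #|F| &
      forall F', intersecting F' -> no_common_vertex F' -> #|F'| = #|F| ->
        total_agreement F' <= total_agreement F].

Lemma extremal_exists F : intersecting F -> no_common_vertex F ->
  exists2 F', extremal F' & #|F| <= #|F'|.
Proof.
move=> FI FN; pose P F := intersecting F && no_common_vertex F.
have PF : P F by apply/andP.
case: (arg_maxnP (fun F : {set edge X} => #|F|) PF) => F1 PF1 F1max.
pose P' F := P F && (#|F| == #|F1|).
have P'F1 : P' F1 by rewrite /P' PF1 eqxx.
case: (arg_maxnP total_agreement P'F1) => F2 /andP[PF2 /eqP F2F1] F2max.
exists F2; last by rewrite F2F1; apply: F1max.
case/andP: (PF2) => F2I F2N; split=> // F' F'I F'N.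
  by rewrite F2F1; apply: F1max; rewrite /P F'I.
by move=> F'F2; apply: F2max; rewrite /P' /P F'I F'N F'F2 F2F1 /=.
Qed.

(** If some reset leaves [F], pushing strictly raises the total agreement at equal size, so the
    pushed family has a common vertex. Pushing changes only coordinate [i], so this vertex lies
    there, and a moved edge shows that it is [o i]. Hence each member either has value [o i] already
    or is moved. *)
Lemma extremal_dichotomy F i : extremal F ->
  (forall x, x \in F -> reset [set i] x \in F) \/
  exists2 v : X i, v != o i &
    forall x, x \in F ->
      x i = o i \/ x i = v /\ reset [set i] x \notin F.
Proof.
move=> [FI FN Fmax Famax].
have [/forall_inP | /forall_inPn[x xF rx]] :=
  boolP [forall x in F, reset [set i] x \in F]; [by left | right].
exists (x i) => [|y yF].
  by apply: contra rx => /eqP xi; rewrite reset1_id.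
have vo : x i != o i by apply: contra rx => /eqP xi; rewrite reset1_id.
pose F' := push F (x i) @: F.
have F'I : intersecting F' by apply: intersecting_push.
have F'c : #|F'| = #|F| by apply: card_in_imset; apply: push_injective.
have := total_agreement_push vo xF erefl rx.
rewrite ltnNge => /negP F'a.
have /forallPn[k /forallPn[w /exists_inPn F'kw]] : ~~ no_common_vertex F'.
  by apply/negP => F'N; apply: F'a; apply: Famax.
have {}F'kw z : z \in F -> push F (x i) z k = w.
  by move=> zF; apply/eqP; rewrite -[_ == _]negbK F'kw // imset_f.
have [ki | ki] := eqVneq k i; last first.
  have [z zF /eqP[]] := no_common_vertexP _ FN k w.
  by rewrite -(F'kw z zF) push_off.
subst k; have wE : w = o i.
  by rewrite -(F'kw x xF) /push eqxx rx resetE inE eqxx.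
have := F'kw y yF; rewrite wE /push.
case: ifP => [/andP[/eqP-> ry] _ | _]; first by right.
by left.
Qed.

End Compression.

(** * Structure of extremal families *)

Section ExtremalStructure.
Variables (r : nat) (X : 'I_r -> finType) (o : edge X).
Implicit Types (x y z : edge X) (F : {set edge X}) (S T : {set 'I_r}).

(** The common target of the two cases: compressed families and majorities both satisfy it, and it
    suffices for the final count. *)
Definition agreement_intersecting F :=
  {in F &, forall x y, agreement o x :&: agreement o y != set0} /\
  {in F, forall x, 1 < #|agreement o x|}.

Lemma compressed_agreement_intersecting F : 0 < r ->
  intersecting F -> no_common_vertex F ->
  (forall i x, x \in F -> reset o [set i] x \in F) -> agreement_intersecting F.
Proof.
move=> r0 /intersectingP FI /no_common_vertexP FN Fr.
have FA : {in F &, forall x y, agreement o x :&: agreement o y != set0}.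
  (* Resetting [x] on [S] destroys every agreement with [y] away from [o], so the agreement that
     remains is with [o]. *)
  move=> x y xF yF; pose S := [set i | (x i == y i) && (x i != o i)].
  have [i] : exists i, reset o S x i = y i.
    by apply: FI => //; apply: reset_closed => // i _ z; apply: Fr.
  rewrite resetE inE; case: ifP => [/andP[/eqP xy /eqP xo] oy | + xy].
    by case: xo; rewrite xy.
  rewrite xy eqxx /= => /negbFE yo.
  by apply/set0Pn; exists i; rewrite !inE xy yo.
split=> // x xF; rewrite ltnNge; apply/negP => x1.
(* If the agreement set of [x] is within one coordinate [i], every member must agree with [o] at
   [i], giving a common vertex. *)
have [i xi] : exists i, agreement o x \subset [set i].
  have [-> | [i ix]] := set_0Vmem (agreement o x).
    by exists (Ordinal r0); rewrite sub0set.
  by exists i; apply/subsetP => j jx; rewrite inE (card_le1_eqP x1 j i).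
have [y yF] := FN i (o i).
have /set0Pn[j /setIP[/(subsetP xi)]] := FA _ _ xF yF.
by rewrite !inE => /eqP -> /eqP ->; rewrite eqxx.
Qed.

Definition majority T : {set edge X} := [set x | 1 < #|agreement o x :&: T|].

Lemma majority_agreement_intersecting T :
  #|T| = 3 -> agreement_intersecting (majority T).
Proof.
move=> T3; split=> [x y | x]; rewrite !inE; last first.
  by move=> /leq_trans; apply; apply/subset_leq_card/subsetIl.
move=> xT yT; apply: contraTneq (leq_add xT yT) => xy0.
rewrite -cardsUI setIACA xy0 set0I cards0 addn0 -setIUl -ltnNge ltnS -T3.
by rewrite subset_leq_card // subsetIr.
Qed.

Section Flip.
Variable v : edge X.

(** Using a full transposition of values makes this injective on all edges, not only on those inside
    a box. *)
Definition flip S x : edge X :=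
  finfun (fun i => if i \in S then tperm (o i) (v i) (x i) else x i).

Lemma flipE S x i :
  flip S x i = if i \in S then tperm (o i) (v i) (x i) else x i.
Proof. by rewrite ffunE. Qed.

Lemma flip_injective S : injective (flip S).
Proof.
move=> x y /ffunP xy; apply/ffunP => i; have := xy i; rewrite !flipE.
by case: ifP => // _ /perm_inj.
Qed.

Definition box T : {set edge X} :=
  [set x : edge X | [forall i in T, (x i == o i) || (x i == v i)]].

Lemma boxP T x :
  reflect (forall i, i \in T -> x i = o i \/ x i = v i) (x \in box T).
Proof.
rewrite inE; apply: (iffP forall_inP) => xT i iT; have := xT i iT.
  by case/orP => /eqP ->; [left | right].
by case=> ->; rewrite eqxx ?orbT.
Qed.

Lemma flip_box S T x : x \in box T -> flip S x \in box T.
Proof.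
move=> /boxP xT; apply/boxP => i iT; rewrite flipE.
case: ifP => _; last exact: xT.
by case: (xT i iT) => ->; rewrite ?tpermL ?tpermR; [right | left].
Qed.

Lemma card_flip_free F S T : F \subset box T ->
  (forall x, x \in F -> flip S x \notin F) -> #|F|.*2 <= #|box T|.
Proof.
move=> FT Fflip; rewrite -addnn -{2}(card_imset F (@flip_injective S)).
have FfF : F :&: flip S @: F = set0.
  apply/setP => x; rewrite !inE; apply/andP => -[xF /imsetP[y yF xE]].
  by move: (Fflip y yF); rewrite -xE xF.
have <- : #|F :|: flip S @: F| = #|F| + #|flip S @: F|.
  by rewrite cardsU FfF cards0 subn0.
rewrite subset_leq_card // subUset FT; apply/subsetP => _ /imsetP[x xF ->].
exact/flip_box/(subsetP FT).
Qed.

(** At each coordinate of [T], an edge of the box or its flip agrees with [o]. Over three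
    coordinates one of the two agrees at least twice, so flipping injects the non-majority edges of
    the box into the majority. *)
Lemma card_box_majority T : #|T| = 3 -> #|box T| <= #|majority T|.*2.
Proof.
move=> T3; rewrite -(cardsID (majority T)) -addnn leq_add //.
  by rewrite subset_leq_card // subsetIr.
rewrite -(card_imset (_ :\: _) (@flip_injective T)) subset_leq_card //.
apply/subsetP => _ /imsetP[x /setDP[/boxP xT xM] ->].
rewrite inE -leqNgt in xM.
have : T \subset (agreement o x :&: T) :|: (agreement o (flip T x) :&: T).
  apply/subsetP => i iT; rewrite !inE flipE iT !andbT.
  by case: (xT i iT) => ->; rewrite ?eqxx // tpermR eqxx orbT.
move/subset_leq_card; rewrite T3 => /leq_trans /(_ (leq_card_setU _ _)) c.
rewrite inE ltnNge; apply/negP => fM.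
by have := leq_trans c (leq_add xM fM).
Qed.

End Flip.

Lemma extremal_majorant F : 0 < r -> extremal o F ->
  exists2 F', agreement_intersecting F' & #|F| <= #|F'|.
Proof.
move=> r0 Fex; have [FI FN Fmax _] := Fex.
pose I := [set i | ~~ [forall x in F, reset o [set i] x \in F]].
have FnI i : i \notin I -> forall x, x \in F -> reset o [set i] x \in F.
  by rewrite inE negbK => /forall_inP.
(* Off [I] the claim is vacuous and [o i] is a placeholder; a total choice is needed to assemble one
   edge [v]. *)
have FIv i : exists w : X i, i \in I -> w != o i /\
    forall x, x \in F -> x i = o i \/ x i = w /\ reset o [set i] x \notin F.
  have [Fi | [w wo Fw]] := extremal_dichotomy i Fex; last by exists w.
  by exists (o i); rewrite inE => /forall_inP.
have [v0 {}FIv] := fin_all_exists FIv.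
pose v : edge X := finfun v0.
have vo i : i \in I -> v i != o i by move=> /FIv[]; rewrite ffunE.
have Fv i x : i \in I -> x \in F ->
    x i = o i \/ x i = v i /\ reset o [set i] x \notin F.
  by move=> /FIv[_ /(_ x)]; rewrite ffunE.
have [I0 | [i iI]] := set_0Vmem I.
  exists F => //; apply: compressed_agreement_intersecting => // i x.
  by apply: FnI; rewrite I0 inE.
(* If [x j = v j], the flip is a reset and is excluded from [F]. If [x j = o j], the flip has value
   [v j] and its reset is [x], which is in [F]. *)
have Fflip j x : j \in I -> x \in F -> flip v [set j] x \notin F.
  move=> jI xF; apply/negP => fF.
  have [xj | [xj rx]] := Fv j x jI xF; last first.
    case/negP: rx; congr (_ \in F): fF; apply/ffunP => k.
    by rewrite flipE resetE inE; case: eqP => // ->; rewrite xj tpermR.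
  have fj : flip v [set j] x j = v j by rewrite flipE inE eqxx xj tpermL.
  case: (Fv j _ jI fF) => [e | [_ /negP[]]].
    by have := vo j jI; rewrite -fj e eqxx.
  congr (_ \in F): xF; apply/ffunP => k.
  by rewrite resetE flipE inE; case: eqP => // ->.
have Fbox T : T \subset I -> F \subset box v T.
  move=> TI; apply/subsetP => x xF; apply/boxP => j /(subsetP TI) jI.
  by case: (Fv j x jI xF) => [|[]]; [left | right].
have FJ x : x \in F -> reset o (~: I) x \in F.
  by apply: reset_closed => j; rewrite inE => /FnI.
suff /card_gt2P[i1 [i2 [i3 [[i1I i2I i3I] [i12 i23 i31]]]]] : 2 < #|I|.
  pose T := [set i1; i2; i3].
  have T3 : #|T| = 3.
    by rewrite /T setUC cardsU1 !inE (negPf i31) eq_sym (negPf i23) cards2 i12.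
  have TI : T \subset I by rewrite !subUset !sub1set i1I i2I i3I.
  exists (majority T); first exact: majority_agreement_intersecting.
  rewrite -leq_double; apply: leq_trans (card_box_majority v T3).
  by apply: (card_flip_free (Fbox _ TI)) => x; apply: Fflip i1I.
(* Let [z] be [x0] flipped at [i].  It is not in F, so by maximality it is
   disjoint from some [y] in F; clearing [y] outside [I] gives [x0] with every
   coordinate of I other than [i] flipped. *)
have [x xF _] := no_common_vertexP _ FN i (o i).
pose x0 := reset o (~: I) x; have x0F : x0 \in F := FJ x xF.
pose z := flip v [set i] x0; have zF : z \notin F := Fflip i x0 iI x0F.
have two j y w : j \in I -> y \in F -> w \in F -> y j != w j ->
    y j = tperm (o j) (v j) (w j).
  move=> jI yF wF; case: (Fv j y jI yF) => [-> | [-> _]];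
    by case: (Fv j w jI wF) => [-> | [-> _]]; rewrite ?eqxx ?tpermL ?tpermR.
have [y yF yz] : exists2 y, y \in F & forall j, y j != z j.
  suff /exists_inP[y yF /forallP] : [exists y in F, [forall j, y j != z j]].
    by exists y.
  apply: contraR zF; rewrite negb_exists_in => /forall_inP Fz.
  have {}Fz y : y \in F -> exists j, y j = z j.
    by move=> yF; have /forallPn[j /negPn/eqP yz] := Fz y yF; exists j.
  have := Fmax (z |: F); rewrite cardsU1.
  case: (z \in F) => // FzN; have := FzN _ _; rewrite add1n ltnn; apply.
    apply/intersectingP => y w /setU1P[-> | yF] /setU1P[-> | wF].
    - by exists i.
    - by have [j wz] := Fz w wF; exists j.
    - exact: Fz.
    - exact: (intersectingP _ FI).
  apply/no_common_vertexP => j u; have [y yF yu] := no_common_vertexP _ FN j u.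
  by exists y => //; rewrite inE yF orbT.
pose y0 := reset o (~: I) y; have y0F : y0 \in F := FJ y yF.
have y0E : y0 = flip v (I :\ i) x0.
  apply/ffunP => j; rewrite resetE flipE in_setD1 inE.
  have [jI /= | jI /=] := boolP (j \in I); last first.
    by rewrite andbF resetE inE jI.
  have := yz j; rewrite flipE inE.
  (* At [i], [y] avoids the flipped value, and only two values occur there, so [y i = x0 i]. *)
  case: (j =P i) => [-> /= yi | _ /=]; last exact: two.
  have [//|] := eqVneq (y i) (x0 i).
  by move/(two i y x0 iI yF x0F) => e; rewrite e eqxx in yi.
rewrite ltnNge (cardsD1 i) iI add1n ltnS; apply/negP => I1.
(* If [I] is just [i], a member with another value at [i], reset off [I], equals [z]. If [I] also
   contains one [k], then [y0] is [x0] flipped at [k] alone. [Fflip] forbids both. *)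
have [I0 | [k kI]] := set_0Vmem (I :\ i).
  have [w wF wi] := no_common_vertexP _ FN i (x0 i).
  case/negP: zF; congr (_ \in F): (FJ w wF); apply/ffunP => j.
  rewrite resetE flipE in_setC in_set1; case: eqP => [-> | /eqP ji].
    by rewrite iI; apply: two.
  have /setP/(_ j) := I0; rewrite in_setD1 ji in_set0 /= => jI.
  by rewrite resetE in_setC jI.
have I1E : I :\ i = [set k].
  apply/setP => j; rewrite inE; apply/idP/eqP => [jI | ->//].
  by rewrite (card_le1_eqP I1 j k).
have /setD1P[_ kI'] := kI.
by have := Fflip k x0 kI' x0F; rewrite -I1E -y0E y0F.
Qed.

End ExtremalStructure.

(** * Weights summed over agreement sets *)

Section LayerSums.
Local Open Scope ring_scope.

Lemma sum_card1 (k : nat) (a : 'I_k -> int) :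
  \sum_(D : {set 'I_k} | #|D| == 1%N) aprod a D = \sum_i a i.
Proof.
rewrite (eq_bigl (mem (set1 @: 'I_k))) => [|D]; last first.
  by apply/cards1P/imsetP => [[i ->] | [i _ ->]]; exists i.
rewrite big_imset /=; last by move=> i j _ _; apply: set1_inj.
by apply: eq_bigr => i _; rewrite /aprod big_set1.
Qed.

Lemma sum_card2 (k : nat) (a : 'I_k -> int) :
  \sum_(D : {set 'I_k} | #|D| == 2%N) aprod a D =
  \sum_(i < k) \sum_(j < k | (i < j)%N) a i * a j.
Proof.
pose A := [set p : 'I_k * 'I_k | (p.1 < p.2)%N].
pose f (p : 'I_k * 'I_k) := [set p.1; p.2].
have -> : \sum_(D : {set 'I_k} | #|D| == 2%N) aprod a D =
          \sum_(D in f @: A) aprod a D.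
  apply: eq_bigl => D; apply/cards2P/imsetP => [[i [j [ij ->]]] | [[i j]]].
    have [lij | lji | /val_inj e] := ltngtP i j; last by rewrite e eqxx in ij.
      by exists (i, j); rewrite ?inE.
    by exists (j, i); rewrite ?inE // /f setUC.
  rewrite inE /= => lij ->; exists i, j; split=> //.
  by apply: contraTneq lij => /= ->; rewrite ltnn.
rewrite big_imset /=; last first.
  move=> [i j] [i' j']; rewrite !inE /f /= => lij lij' /setP e.
  have := e i; have := e j; rewrite !inE !eqxx !orbT /=.
  move=> /esym /orP[] /eqP jE /esym /orP[] /eqP iE; subst i j;
    rewrite ?ltnn // in lij *.
  by have := ltn_trans lij lij'; rewrite ltnn.
rewrite pair_big_dep /=; apply: eq_big => [p | [i j] lij]; rewrite ?inE //.
rewrite inE /= in lij; rewrite /aprod big_setU1 ?big_set1 //= inE.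
by apply: contraTneq lij => ->; rewrite ltnn.
Qed.

(* For each pair [e], exactly one of [e] and its complement is a layer: [e] when
   it is an edge of [G], the complement otherwise. *)
Definition layers (G : {set {set 'I_5}}) : {set {set 'I_5}} :=
  [set S : {set 'I_5} | [|| (3 < #|S|)%N, (#|S| == 3%N) && (~: S \notin G) | S \in G]].

(** In terms of the disagreement set [D], both sides agree term by term: sizes 0 and 1 always count,
    size 2 counts unless [D] is in [G], and size 3 counts when the complement of [D] is in [G]. *)
Lemma sum_layers (a : 'I_5 -> int) (G : {set {set 'I_5}}) : graph G ->
  \sum_(S in layers G) aprod a (~: S) =
  1 + \sum_(i < 5) a i + \sum_(i < 5) \sum_(j < 5 | (i < j)%N) a i * a j
    + \sum_(e in G) Delta a e.
Proof.
move=> /forall_inP gG; rewrite -sum_card1 -sum_card2.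
rewrite (reindex_inj (@setC_inj 'I_5)) /= /Delta sumrB addrA.
have -> : 1 = \sum_(D : {set 'I_5} | #|D| == 0%N) aprod a D.
  by rewrite (big_pred1 set0) => [|D]; rewrite ?/aprod ?big_set0 ?cards_eq0.
have -> : \sum_(e in G) aprod a (~: e) = \sum_(D | ~: D \in G) aprod a D.
  by rewrite [RHS](reindex_inj (@setC_inj 'I_5)); apply: eq_bigl => D; rewrite setCK.
rewrite [\sum_(D | _ \in layers G) _]big_mkcond
        2![\sum_(D | #|_| == _) _]big_mkcond.
rewrite [\sum_(D | #|_| == 2%N) _]big_mkcond
        [\sum_(D | ~: D \in G) _]big_mkcond.
rewrite [\sum_(D in G) _]big_mkcond -!big_split -sumrB /=.
apply: eq_bigr => D _; rewrite setCK inE setCK.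
have cD : #|~: D| = (5 - #|D|)%N by rewrite cardsCs setCK card_ord.
have := max_card D; rewrite card_ord.
case: (boolP (D \in G)) => [/gG | _]; case: (boolP (~: D \in G)) => [/gG | _];
  rewrite cD; case: #|D| => [|[|[|[|[|[|d]]]]]] //= *;
  by do ?rewrite (add0r, addr0, subr0, subrr).
Qed.

End LayerSums.

(** * Families prescribed by an intersecting graph *)

Section PentapartiteFamilies.
Variables (X : 'I_5 -> finType) (a : 'I_5 -> int) (o v : edge X).
Hypothesis cardX : forall i, (#|X i|%:Z = a i + 1)%R.
Hypothesis v_neq_o : forall i, v i != o i.
Local Open Scope ring_scope.

Definition layered_family (G : {set {set 'I_5}}) : {set edge X} :=
  [set x | agreement o x \in layers G].

(** Coordinates in [S] are forced; each other one has [a i] values different from [o i]. *)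
Lemma card_agreement S :
  #|[set x : edge X | agreement o x == S]|%:Z = aprod a (~: S).
Proof.
pose A i := if i \in S then [set o i] else [set~ o i].
have -> : [set x : edge X | agreement o x == S] = setXn A.
  apply/setP => x; rewrite inE; apply/eqP/setXnP => [xS i | xA].
    by rewrite /A -xS inE; case: eqP => [->|/eqP]; rewrite !inE.
  apply/setP => i; rewrite inE; have := xA i; rewrite /A.
  by case: ifP => _; rewrite !inE // => /negPf.
rewrite cardsXn (big_morph Posz PoszM (erefl _)) /aprod [RHS]big_mkcond /=.
apply: eq_bigr => i _; rewrite /A inE; case: ifP => _ /=; first by rewrite cards1.
have := cardsC [set o i]; rewrite cards1 => c.
by have := cardX i; rewrite -c PoszD addrC => /addIr.
Qed.

Lemma card_layered_family G : graph G ->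
  #|layered_family G|%:Z =
  1 + \sum_(i < 5) a i + \sum_(i < 5) \sum_(j < 5 | (i < j)%N) a i * a j
    + \sum_(e in G) Delta a e.
Proof.
move=> gG; rewrite -sum_layers // -sum1_card.
rewrite (partition_big (agreement o) (mem (layers G))) /=; last first.
  by move=> x; rewrite inE.
rewrite (big_morph Posz PoszD (erefl _)); apply: eq_bigr => S SG.
rewrite -card_agreement -sum1dep_card; congr Posz; apply: eq_bigl => x.
by rewrite inE andb_idl // => /eqP ->.
Qed.

(** Two layers outside [G] have at least three elements each, too many to be disjoint in five
    points. A layer disjoint from a pair of [G] would have to be its complement, which is excluded,
    or another edge of [G]. *)
Lemma layers_intersecting G : G \in intersecting_graphs 5 ->
  {in layers G &, forall S S', S :&: S' != set0}.
Proof.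
rewrite inE => /andP[/forall_inP gG /forall_inP iG] S S' SG S'G.
have subC (A B : {set 'I_5}) : A :&: B = set0 -> B \subset ~: A.
  by move=> AB; rewrite -disjoints_subset -setI_eq0 setIC AB.
have cardC (A : {set 'I_5}) : #|~: A| = (5 - #|A|)%N.
  by rewrite cardsCs setCK card_ord.
have meetG (A B : {set 'I_5}) : A \in layers G -> B \in G -> A :&: B != set0.
  move=> AL BG; apply/eqP => AB; have BA := subC _ _ AB; have B2 := gG B BG.
  move: AL; rewrite inE => /or3P[A4 | /andP[/eqP A3 /negP[]] | AG].
  - have := subset_leq_card BA; rewrite cardC (eqP B2).
    by case: #|A| A4 => [|[|[|[|[|m]]]]].
  - suff /eqP <- : B == ~: A by [].
    by rewrite eqEcard BA cardC A3 (eqP B2).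
  - by have /forall_inP/(_ B BG) := iG A AG; rewrite AB eqxx.
have [S'iG | S'nG] := boolP (S' \in G); first exact: meetG.
have [SiG | SnG] := boolP (S \in G); first by rewrite setIC; apply: meetG.
move: SG S'G; rewrite !inE (negPf S'nG) (negPf SnG) !orbF => SG S'G.
apply/eqP => /subC/subset_leq_card; rewrite cardC.
by case: #|S| SG => [|[|[|[|[|m]]]]] //; case: #|S'| S'G => [|[|[|[|m']]]].
Qed.

Lemma intersecting_layered_family G : G \in intersecting_graphs 5 ->
  intersecting (layered_family G).
Proof.
move=> iG; apply/intersectingP => x y /[1!inE] xG /[1!inE] yG.
have /set0Pn[i] := layers_intersecting iG xG yG.
by rewrite !inE => /andP[/eqP xi /eqP yi]; exists i; rewrite xi yi.
Qed.

(** Agreement sets of size 5 and 4 are always layers: [o] avoids every vertex other than its own,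
    and [o] flipped at [i] avoids [o i]. *)
Lemma no_common_vertex_layered_family G : no_common_vertex (layered_family G).
Proof.
apply/no_common_vertexP => i u; have [-> | uo] := eqVneq u (o i); last first.
  exists o; last by rewrite eq_sym.
  rewrite inE; have -> : agreement o o = setT by apply/setP => j; rewrite !inE eqxx.
  by rewrite inE cardsT card_ord.
exists (flip o v [set i] o); last by rewrite flipE inE eqxx tpermL.
rewrite inE.
have -> : agreement o (flip o v [set i] o) = [set~ i].
  apply/setP => j; rewrite !inE flipE inE; case: (j =P i) => [-> | _].
    by rewrite tpermL (negPf (v_neq_o i)).
  by rewrite eqxx.
by rewrite inE cardsC1 card_ord.
Qed.

Lemma agreement_intersecting_layered F : agreement_intersecting o F ->
  exists2 G, G \in intersecting_graphs 5 & F \subset layered_family G.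
Proof.
move=> [FA F2].
(* [G] collects the agreement sets of size two. An agreement set of size three cannot have its
   complement in [G], since the two would be disjoint. *)
exists [set e : {set 'I_5} |
  (#|e| == 2) && [exists x in F, agreement o x == e]].
  rewrite inE; apply/andP; split.
    by apply/forall_inP => e; rewrite inE => /andP[].
  apply/forall_inP => e; rewrite inE => /andP[_ /exists_inP[x xF /eqP <-]].
  apply/forall_inP => e'; rewrite inE => /andP[_ /exists_inP[y yF /eqP <-]].
  exact: FA.
apply/subsetP => x xF; rewrite !inE negb_and.
have xx : [exists y in F, agreement o y == agreement o x].
  by apply/exists_inP; exists x.
have -> : [exists y in F, agreement o y == ~: agreement o x] = false.
  apply/exists_inP => -[y yF /eqP yx]; have /set0Pn[i] := FA x y xF yF.
  by rewrite yx setICr inE.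
by rewrite xx orbT !andbT; case: #|agreement o x| (F2 x xF) => [|[|[|[|m]]]].
Qed.

End PentapartiteFamilies.

(** * Intersecting graphs as subgraphs of stars and triangles *)

Lemma intersecting_graphsE k :
  intersecting_graphs k.+1 = star_triangle_subgraphs k.+1.
Proof.
apply/setP => G; rewrite !inE; apply/andP/orP.
  case=> /forall_inP gG /forall_inP iG.
  have {}iG : {in G &, forall e f, e :&: f != set0}.
    by move=> e f eG fG; have /forall_inP := iG e eG; apply.
  have [-> | [e eG]] := set_0Vmem G.
    by left; apply/existsP; exists ord0; rewrite sub0set.
  have [|/existsPn nostar] := boolP [exists v, G \subset star v]; first by left.
  right; have /cards2P[x [y [xy eE]]] := gG e eG.
  (* Without a star, every vertex is avoided by some edge. An edge avoiding [x] is some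
     [[set y; z]], one avoiding [y] is then [[set x; z]], and with [e] they form a triangle. *)
  have avoid w : exists2 f, f \in G & w \notin f.
    have /subsetPn[f fG] := nostar w; rewrite inE (gG f fG) /= => wf.
    by exists f.
  have other f g u w : f \in G -> g \in G -> f = [set u; w] -> u \notin g -> w \in g.
    move=> fG gG' fE ug; have /set0Pn[i] := iG f g fG gG'.
    by rewrite fE !inE => /andP[/orP[] /eqP -> //]; rewrite (negPf ug).
  have [f fG xf] := avoid x; have yf := other _ _ _ _ eG fG eE xf.
  have [z zy fE] : exists2 z, z != y & f = [set y; z].
    have := gG f fG; rewrite (cardsD1 y) yf => /cards1P[z fz].
    exists z; last by rewrite -fz setD1K.
    by have /setP/(_ z) := fz; rewrite !inE eqxx => /andP[].
  have xz : x != z by apply: contraNneq xf => ->; rewrite fE !inE eqxx orbT.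
  have [g gG' yg] := avoid y.
  have xg : x \in g by apply: other eG gG' _ yg; rewrite eE setUC.
  have zg : z \in g := other _ _ _ _ fG gG' fE yg.
  have gE : g = [set x; z].
    apply/esym/eqP; rewrite eqEcard subUset !sub1set xg zg /= (eqP (gG g gG')).
    by rewrite cards2 xz.
  have T3 : #|[set x; y; z]| = 3.
    by rewrite setUC cardsU1 !inE (negPf zy) eq_sym (negPf xz) cards2 xy.
  apply/existsP; exists [set x; y; z]; rewrite T3 eqxx /=.
  apply/subsetP => h hG; rewrite inE gG //=.
  (* An end [u] outside the triangle would force the other end [w] into all three of its edges,
     which share no vertex. *)
  have inT u w : h = [set u; w] -> u \in [set x; y; z].
    move=> hE; apply: contraT; rewrite !inE !negb_or -andbA => /and3P[ux uy uz].
    have := other _ _ _ _ hG eG hE; have := other _ _ _ _ hG fG hE.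
    have := other _ _ _ _ hG gG' hE.
    rewrite eE fE gE !inE !negb_or ux uy uz.
    move=> /(_ isT) wxz /(_ isT) wyz /(_ isT) wxy.
    case/orP: wxy wxz wyz => /eqP -> => [_ | ].
      by rewrite (negPf xy) (negPf xz).
    by rewrite eq_sym (negPf xy) eq_sym (negPf zy).
  have /cards2P[u [w [_ hE]]] := gG h hG.
  by rewrite hE subUset !sub1set (inT u w) // (inT w u) // hE setUC.
case=> [/existsP[v /subsetP Gv] | /existsP[T /andP[/eqP T3 /subsetP GT]]].
  split; apply/forall_inP => e /Gv; rewrite inE => /andP[// _ ve].
  apply/forall_inP => f /Gv; rewrite inE => /andP[_ vf].
  by apply/set0Pn; exists v; rewrite inE ve.
split; apply/forall_inP => e /GT; rewrite inE => /andP[// /eqP e2 eT].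
apply/forall_inP => f /GT; rewrite inE => /andP[/eqP f2 fT].
rewrite -cards_eq0; have := subset_leq_card (_ : e :|: f \subset T).
rewrite subUset eT fT => /(_ isT); rewrite T3 cardsU e2 f2.
by case: #|e :&: f|.
Qed.

(** * The exact value by matching bounds *)

Unset Implicit Arguments.
Local Open Scope ring_scope.
Theorem theorem4p2 (n : 'I_5 -> nat) (n_ge2 : forall i, (2 <= n i)%N)
  (X : 'I_5 -> finType) (cardX : forall i, #|X i| = n i)
  (a : 'I_5 -> int) (aE : forall i, a i = (n i)%:Z - 1) :
  (m0 X 1)%:Z = 1 + \sum_(i < 5) a i
                + \sum_(i < 5) \sum_(j < 5 | (i < j)%N) a i * a j
                + max_Delta a (intersecting_graphs 5)
  /\ max_Delta a (intersecting_graphs 5)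
     = max_Delta a (star_triangle_subgraphs 5).
Proof.
split; last by rewrite intersecting_graphsE.
have cX i : #|X i|%:Z = a i + 1 by rewrite aE cardX subrK.
have /fin_all_exists[w ow] : forall i, exists p : X i * X i, p.2 != p.1.
  move=> i; have /card_gt1P[p [q [_ _ pq]]] : (1 < #|X i|)%N by rewrite cardX.
  by exists (q, p).
pose o : edge X := [ffun i => (w i).1]; pose v : edge X := [ffun i => (w i).2].
have vo i : v i != o i by rewrite !ffunE.
set M := max_Delta a (intersecting_graphs 5); set c := (X in _ = X + M).
have leM G : G \in intersecting_graphs 5 -> #|layered_family o G|%:Z <= c + M.
  move=> iG; have := iG; rewrite inE => /andP[gG _].
  by rewrite (card_layered_family o cX) // lerD2l /M /max_Delta; apply: le_bigmax_cond.
have G0 : set0 \in intersecting_graphs 5.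
  by rewrite inE; apply/andP; split; apply/forall_inP => e; rewrite inE.
(* Nonnegativity lets the integer bound be read as a natural number in [m0_leq]. *)
have cM0 : 0 <= c + M by apply: le_trans (leM _ G0).
apply/eqP; rewrite eq_le; apply/andP; split.
  rewrite -(gez0_abs cM0) lez_nat; apply: (m0_leq o) => // F FI FN.
  rewrite -lez_nat gez0_abs //.
  have [F1 F1ex FF1] := extremal_exists o FI FN.
  have [F2 F2A F12] := extremal_majorant (ltn0Sn 4) F1ex.
  have [G iG F2G] := agreement_intersecting_layered F2A.
  apply: le_trans (leM G iG); rewrite lez_nat.
  exact/(leq_trans FF1)/(leq_trans F12)/subset_leq_card.
have geM G : G \in intersecting_graphs 5 ->
    \sum_(e in G) Delta a e <= (m0 X 1)%:Z - c.
  move=> iG; have := iG; rewrite inE => /andP[gG _].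
  rewrite lerBrDl -(card_layered_family o cX gG) lez_nat.
  apply: (leq_m0 o) => //; first exact: intersecting_layered_family.
  exact: no_common_vertex_layered_family vo G.
rewrite -lerBrDl; apply: bigmax_le => //.
(* The default value 0 of the maximum is the sum over the empty graph. *)
by have := geM _ G0; rewrite big_set0.
Qed.
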